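(* Let $X\vee H$ be a simple unweighted double cone on a graph $H$ with $m$ vertices. 1. Assume $H$ is $d$-regular. If $X\vee H$ is a disconnected double cone, then its apexes are strongly cospectral with respect to $\mathbf{A}(X\vee H)$. If $X\vee H$ is a connected double cone and $\beta\neq-\gamma$, then the apexes of $X\vee H$ are strongly cospectral with respect to $\mathbf{A}(X\vee H)$ if and only if $d\neq m-1$ (i.e., $H\not\cong K_m$). 2. Let $\beta=-\gamma$. If $X\vee H$ is a disconnected double cone, then its apexes are strongly cospectral with respect to $\mathbf{A}(X\vee H)$. If $X\vee H$ is a connected double cone, then its apexes are not strongly cospectral with respect to $\mathbf{A}(X\vee H)$.
   Context: All graphs here are finite, simple (no loops, no multiple edges) and unweighted (all edge weights one); $H$ has $m\geq1$ vertices and need not be connected. $X\vee H$ denotes the join of $X$ and $H$. It is a double cone on $H$ if $X$ has two vertices, called the apexes: a connected double cone if $X=K_2$ and a disconnected double cone if $X=O_2$ (the empty graph on two vertices). For a graph $G$ with adjacency matrix $A(G)$ and diagonal degree matrix $D(G)$, $\mathbf{A}(G)=\alpha I+\beta D(G)+\gamma A(G)$, where $\alpha,\beta,\gamma\in\mathbb{R}$ are fixed with $\gamma\neq0$. With spectral decomposition $\mathbf{A}(G)=\sum_j\lambda_jE_j$ ($\lambda_j$ distinct eigenvalues, $E_j$ orthogonal projections onto the eigenspaces), vertices $u,v$ are strongly cospectral with respect to $\mathbf{A}(G)$ if $E_j\mathbf{e}_u=\pm E_j\mathbf{e}_v$ for each $j$, where $\mathbf{e}_u$ is the characteristic vector of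 $u$. *)

(* Defs.v *)
From HB Require Import structures.
From mathcomp Require Import all_boot all_order all_algebra.
Set Implicit Arguments.
Unset Strict Implicit.
Unset Printing Implicit Defensive.
Import Order.TTheory GRing.Theory Num.Theory.
Local Open Scope ring_scope.

Record sgraph := SGraph {
  vertex :> finType;
  edge : rel vertex;
  edge_sym : symmetric edge;
  edge_irr : irreflexive edge }.

Arguments edge {s} x y.

Definition deg (G : sgraph) (x : G) : nat := #|[set y | edge x y]|.

Definition regular (G : sgraph) (d : nat) : Prop := forall x : G, deg x = d.

Definition isomorphic (G H : sgraph) : Prop :=
  exists2 f : G -> H, bijective f & forall x y, edge (f x) (f y) = edge x y.

Section Complete.
Variable n : nat.
Definition complete_rel : rel 'I_n := fun x y => x != y.
Lemma complete_sym : symmetric complete_rel.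
Proof. by move=> x y; rewrite /complete_rel eq_sym. Qed.
Lemma complete_irr : irreflexive complete_rel.
Proof. by move=> x; rewrite /complete_rel eqxx. Qed.
Definition complete_graph := SGraph complete_sym complete_irr.

Definition empty_rel : rel 'I_n := fun _ _ => false.
Lemma empty_sym : symmetric empty_rel. Proof. by []. Qed.
Lemma empty_irr : irreflexive empty_rel. Proof. by []. Qed.
Definition empty_graph := SGraph empty_sym empty_irr.
End Complete.

Section Join.
Variables X H : sgraph.
Definition join_rel : rel (X + H)%type := fun s t =>
  match s, t with
  | inl x, inl y => edge x y
  | inr x, inr y => edge x y
  | _, _ => true
  end.
Lemma join_sym : symmetric join_rel.
Proof. by case=> x [] y //=; rewrite edge_sym. Qed.
Lemma join_irr : irreflexive join_rel.
Proof. by case=> x /=; rewrite edge_irr. Qed.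
Definition join := SGraph join_sym join_irr.
End Join.

Definition connected_double_cone (H : sgraph) := join (complete_graph 2) H.
Definition disconnected_double_cone (H : sgraph) := join (empty_graph 2) H.

Section Matrices.
Variables (R : fieldType) (G : sgraph).

Definition adjacency_mx : 'M[R]_#|G| :=
  \matrix_(i, j) (edge (enum_val i) (enum_val j))%:R.

Definition degree_mx : 'M[R]_#|G| := diag_mx (\row_i (deg (enum_val i))%:R).

Definition gen_adjacency_mx (alpha beta gamma : R) : 'M[R]_#|G| :=
  alpha%:M + beta *: degree_mx + gamma *: adjacency_mx.

(* As is customary for row spaces, vectors are rows and matrices act on the
   right; all matrices involved here are symmetric. *)
Definition char_vec (u : G) : 'rV[R]_#|G| := delta_mx 0 (enum_rank u).
End Matrices.

(* The rows of [kermx U^T] span the orthogonal complement of the row space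
   of U for the standard dot product. *)
Definition orth_proj (R : fieldType) m n (U : 'M[R]_(m, n)) : 'M[R]_n :=
  proj_mx <<U>>%MS (kermx U^T).

Section OrthProj.
Variables (R : realFieldType) (m n : nat) (U : 'M[R]_(m, n)).

Lemma cap_orth : (<<U>> :&: kermx U^T = 0)%MS.
Proof.
apply/eqP/rowV0P => v; rewrite sub_capmx genmxE => /andP[/submxP[w vE]].
move/sub_kermxP => vU.
have : v *m v^T = 0 by rewrite {2}vE trmx_mul mulmxA vU mul0mx.
move/matrixP/(_ 0 0); rewrite !mxE => /eqP.
rewrite psumr_eq0 => [/allP v0|i _]; last by rewrite mxE -expr2 sqr_ge0.
apply/rowP => i; have := v0 i (mem_index_enum _).
by rewrite !mxE mulf_eq0 orbb => /eqP.
Qed.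

Lemma add_orth : (<<U>> + kermx U^T :=: 1%:M)%MS.
Proof.
apply/eqmxP; rewrite submx1 sub1mx /row_full.
have := mxrank_sum_cap <<U>>%MS (kermx U^T); rewrite cap_orth mxrank0 addn0 => ->.
by rewrite mxrank_ker mxrank_tr mxrank_gen (subnKC (rank_leq_col U)) eqxx.
Qed.

Lemma orth_proj_id p (W : 'M_(p, n)) : (W <= U)%MS -> W *m orth_proj U = W.
Proof. by move=> sWU; rewrite proj_mx_id ?cap_orth // genmxE. Qed.

Lemma orth_proj_0 p (W : 'M_(p, n)) : W *m U^T = 0 -> W *m orth_proj U = 0.
Proof. by move=> WU; rewrite proj_mx_0 ?cap_orth //; apply/sub_kermxP. Qed.

Lemma orth_projE : (orth_proj U :=: U)%MS.
Proof.
apply/eqmxP/andP; split.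
  by rewrite -[orth_proj U]mul1mx (submx_trans (proj_mx_sub _ _ _)) ?genmxE.
by rewrite -{1}(orth_proj_id (submx_refl U)) submxMl.
Qed.

Lemma orth_proj_idem : orth_proj U *m orth_proj U = orth_proj U.
Proof. by rewrite orth_proj_id // orth_projE. Qed.

Lemma orth_proj_sym : (orth_proj U)^T = orth_proj U.
Proof.
set P := orth_proj U.
have PU : (1%:M - P) *m U^T = 0.
  apply/sub_kermxP; rewrite -[P]mul1mx.
  by rewrite proj_mx_compl_sub // add_orth.
have PP : (1%:M - P) *m P^T = 0.
  have /submxP[w PE] : (P <= U)%MS by rewrite orth_projE.
  by rewrite {2}PE trmx_mul mulmxA PU mul0mx.
move/eqP: PP; rewrite mulmxBl mul1mx subr_eq0 => /eqP PE.
have : (P *m P^T)^T = P *m P^T by rewrite trmx_mul trmxK.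
by rewrite -PE trmxK.
Qed.
End OrthProj.

Definition spectral_idempotent (R : fieldType) n (M : 'M[R]_n) (a : R) :=
  orth_proj (eigenspace M a).

Definition strongly_cospectral (R : fieldType) (G : sgraph) (M : 'M[R]_#|G|)
    (u v : G) : Prop :=
  forall a, eigenvalue M a ->
    let E := spectral_idempotent M a in
    char_vec R u *m E = char_vec R v *m E \/
    char_vec R u *m E = - (char_vec R v *m E).

(* Main.v *)
Require Import Defs.
From mathcomp Require Import all_boot all_order all_algebra.
From mathcomp Require Import reals.
From mathcomp Require Import ring.
Import Order.TTheory GRing.Theory Num.Theory.
Local Open Scope ring_scope.

(** The two apexes [u], [v] of a double cone are twins: [e_u - e_v] is an
eigenvector of the generalized adjacency matrix, for the eigenvalue
[theta = alpha + beta (m + e) - gamma e], where [e] is 1 if the apexes are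
adjacent and 0 otherwise.  Every other eigenspace is orthogonal to
[e_u - e_v], so there [e_u] and [e_v] have the same projection.  On the
[theta]-eigenspace the two projections differ by [e_u - e_v], which is not 0,
so they can only be opposite.  Hence the apexes are strongly cospectral exactly
when every [theta]-eigenvector [x] satisfies [x_u + x_v = 0]
([strongly_cospectral_twins]).

Suppose that [(beta + gamma) deg y = c] for all [y] in [H].  This covers both a
[d]-regular base, with [c = (beta + gamma) d], and [beta = - gamma], with
[c = 0].  Let [x] be a [theta]-eigenvector, [s = x_u + x_v], and [S] the sum of
[x] over [H].  The equation at an apex says [S = - e s].  Summing the equations
over [H], each [x_y] is counted [deg y] times by the adjacency terms, so that
the degrees only enter through [(beta + gamma) deg y = c], and
<<
  (alpha + 2 beta + c) S + gamma m s = theta S.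
>>
If [e = 0], this is [gamma m s = 0], so [s = 0].  If [e = 1], it is
[((beta + gamma) (m - 1) - c) s = 0], so [s = 0] unless
[c = (beta + gamma) (m - 1)]; in that case the vector equal to [1] on the apexes
and to [- 2 / m] on [H] is a [theta]-eigenvector with [s = 2].  Thus the apexes
fail to be strongly cospectral exactly when they are adjacent and
[c = (beta + gamma) (m - 1)] ([strongly_cospectral_double_cone]), and all the
claims are instances of this criterion.  Finally, a [d]-regular graph on [m]
vertices is complete exactly when [d = m - 1] ([regular_completeP]). *)

(** * Strong cospectrality of twins *)

Lemma orth_proj_eq0 {R : realFieldType} {p n : nat} (U : 'M[R]_(p, n))
    (x : 'rV[R]_n) : (x *m orth_proj U == 0) = (x *m U^T == 0).
Proof.
apply/eqP/eqP => [xP0|]; last exact: orth_proj_0.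
by rewrite -[U](orth_proj_id (submx_refl U)) trmx_mul orth_proj_sym mulmxA xP0
  mul0mx.
Qed.

(** A symmetric matrix has mutually orthogonal eigenspaces. *)
Lemma eigenvector_orth {R : realFieldType} {n : nat} (M : 'M[R]_n) (a b : R)
    (w : 'rV[R]_n) :
  M^T = M -> w *m M = a *: w -> a != b ->
  w *m spectral_idempotent M b = 0.
Proof.
move=> symM wM neq_ab; apply: orth_proj_0; set U := eigenspace M b.
have UM : U *m M = b *: U by apply/eigenspaceP.
have : (a - b) *: (w *m U^T) = 0.
  apply/eqP; rewrite scalerBl subr_eq0 scalemxAl -wM -mulmxA; apply/eqP.
  by rewrite -{1}symM -trmx_mul UM linearZ /= scalemxAr.
by move/eqP; rewrite scaler_eq0 subr_eq0 (negPf neq_ab) => /eqP.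
Qed.

(** The eigenspaces other than that of [theta] impose nothing, and on the latter
the sign must be negative because the two projections differ by
[char_vec R u - char_vec R v], which is its own projection. *)
Lemma strongly_cospectral_twins {R : realFieldType} {G : sgraph}
    {M : 'M[R]_#|G|} {u v : G} {theta : R} :
  M^T = M -> u != v ->
  (char_vec R u - char_vec R v) *m M = theta *: (char_vec R u - char_vec R v) ->
  strongly_cospectral M u v <->
  forall x : 'rV_#|G|, x *m M = theta *: x ->
    x 0 (enum_rank u) + x 0 (enum_rank v) = 0.
Proof.
move=> symM neq_uv; set eu := char_vec R u; set ev := char_vec R v => wM.
have w_neq0 : eu - ev != 0.
  apply: contraNneq neq_uv => /rowP/(_ (enum_rank u)).
  rewrite !mxE !eqxx /= (inj_eq enum_rank_inj).
  by case: eqP => // _ /eqP; rewrite subr0 oner_eq0.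
have wE : (eu - ev) *m spectral_idempotent M theta = eu - ev.
  by apply: orth_proj_id; apply/eigenspaceP.
have sumE (x : 'rV[R]_#|G|) :
    x 0 (enum_rank u) + x 0 (enum_rank v) = ((eu + ev) *m x^T) 0 0.
  by rewrite mulmxDl mxE -!rowE !mxE.
split=> [SC x xM|sum0 a _].
  have ev_theta : eigenvalue M theta by apply/eigenvalueP; exists (eu - ev).
  have /eqP : (eu + ev) *m spectral_idempotent M theta = 0.
    rewrite mulmxDl; case: (SC theta ev_theta) => /= E.
      by case/eqP: w_neq0; rewrite -wE mulmxBl E subrr.
    by rewrite E addNr.
  rewrite orth_proj_eq0 => /eqP sU.
  have /submxP[y ->] : (x <= eigenspace M theta)%MS by apply/eigenspaceP.
  by rewrite sumE trmx_mul mulmxA sU mul0mx mxE.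
have [->|neq_at] := eqVneq a theta; last first.
  left; apply/eqP; rewrite -subr_eq0 -mulmxBl; apply/eqP.
  by apply: eigenvector_orth symM wM _; rewrite eq_sym.
(* Apply the hypothesis to each of the rows spanning the eigenspace. *)
right; apply/eqP; rewrite -addr_eq0 -mulmxDl orth_proj_eq0; apply/eqP/rowP=> j.
set U := eigenspace M theta.
have := sum0 (row j U); rewrite sumE => rowj0.
rewrite [RHS]mxE -{}[RHS]rowj0; last by apply/eigenspaceP; rewrite row_sub.
by rewrite tr_row !mxE; apply: eq_bigr => i _; rewrite !mxE.
Qed.

(** * Eigenvectors as functions on the vertices *)

Section FunctionsOnVertices.
Context {R : realFieldType} {G : sgraph}.
Implicit Types (f : G -> R).

Definition row_of_fun f : 'rV[R]_#|G| := \row_i f (enum_val i).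

Lemma row_of_funK (x : 'rV[R]_#|G|) :
  row_of_fun (fun y => x 0 (enum_rank y)) = x.
Proof. by apply/rowP => i; rewrite mxE enum_valK. Qed.

Lemma gen_adjacency_mx_sym (alpha beta gamma : R) :
  (gen_adjacency_mx G alpha beta gamma)^T = gen_adjacency_mx G alpha beta gamma.
Proof.
rewrite /gen_adjacency_mx /degree_mx !linearD !linearZ /= tr_scalar_mx tr_diag_mx.
by congr (_ + _ *: _); apply/matrixP => i j; rewrite !mxE edge_sym.
Qed.

Lemma gen_adjacency_eigenP (alpha beta gamma a : R) f :
  row_of_fun f *m gen_adjacency_mx G alpha beta gamma = a *: row_of_fun f <->
  forall y, (alpha + beta * (deg y)%:R) * f y
            + gamma * \sum_x (edge x y)%:R * f x = a * f y.
Proof.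
have entry y : (row_of_fun f *m gen_adjacency_mx G alpha beta gamma)
      0 (enum_rank y) =
    (alpha + beta * (deg y)%:R) * f y + gamma * \sum_x (edge x y)%:R * f x.
  rewrite /gen_adjacency_mx !mulmxDr -!scalemxAr mul_mx_scalar mul_mx_diag.
  rewrite !mxE enum_rankK (reindex _ (onW_bij _ (@enum_val_bij G))) /=.
  under eq_bigr do rewrite !mxE enum_rankK mulrC.
  by ring.
split=> [/rowP E y|E].
  by rewrite -entry E !mxE enum_rankK.
by apply/rowP => i; rewrite -[i]enum_valK entry E !mxE !enum_rankK.
Qed.

Lemma natr_deg (y : G) : (deg y)%:R = \sum_x (edge x y)%:R :> R.
Proof.
rewrite /deg -sum1dep_card natr_sum big_mkcond /=.
by apply: eq_bigr => x _; rewrite edge_sym; case: edge.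
Qed.

End FunctionsOnVertices.

(** * The criterion for double cones *)

Section DoubleCone.
Context {R : realFieldType} {X H : sgraph} {u v : X}.
Context (alpha beta gamma c : R).
Context (gamma_neq0 : gamma != 0) (H_gt0 : (0 < #|H|)%N).
Context (neq_uv : u != v) (X_uv : forall x, x = u \/ x = v).
Context (deg_c : forall y : H, (beta + gamma) * (deg y)%:R = c).

Let e : R := (edge u v)%:R.
Let m : R := #|H|%:R.
Let theta : R := alpha + beta * (m + e) - gamma * e.
Let M := gen_adjacency_mx (join X H) alpha beta gamma.

Lemma sum_apexes (F : X -> R) : \sum_x F x = F u + F v.
Proof.
rewrite (bigD1 u) //= (bigD1 v) 1?eq_sym //= big1 ?addr0 // => x.
by case: (X_uv x) => ->; rewrite eqxx ?andbF.
Qed.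

Lemma sum_cone (F : join X H -> R) :
  \sum_x F x = F (inl u) + F (inl v) + \sum_y F (inr y).
Proof. by rewrite big_sumType /= sum_apexes. Qed.

Lemma deg_apex (x : X) : (deg (inl x : join X H))%:R = m + e :> R.
Proof.
rewrite natr_deg sum_cone /= sumr_const -/m addrC /e.
by case: (X_uv x) => ->; rewrite edge_irr ?addr0 ?add0r // edge_sym.
Qed.

Lemma deg_base (y : H) : (deg (inr y : join X H))%:R = 2 + (deg y)%:R :> R.
Proof. by rewrite natr_deg sum_cone /= -natr_deg. Qed.

(** For the eigenvalue [theta], the equations at the two apexes coincide: the
diagonal entry minus [theta] is [gamma * e], which adds the missing apex to the
sum over the neighbours.  Both equations carry a factor [gamma]. *)
Lemma cone_eigenP (f : join X H -> R) :
  row_of_fun f *m M = theta *: row_of_fun f <->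
  e * (f (inl u) + f (inl v)) + \sum_y f (inr y) = 0 /\
  forall y : H, (alpha + beta * (2 + (deg y)%:R)) * f (inr y)
    + gamma * (f (inl u) + f (inl v) + \sum_z (edge z y)%:R * f (inr z))
    = theta * f (inr y).
Proof.
have apexE x : \sum_z (edge z (inl x : join X H))%:R * f z =
    e * (f (inl u) + f (inl v) - f (inl x)) + \sum_y f (inr y).
  rewrite sum_cone /= /e; under eq_bigr do rewrite mul1r.
  by case: (X_uv x) => ->; rewrite edge_irr ?[edge v u]edge_sym /=; ring.
have baseE y : \sum_z (edge z (inr y : join X H))%:R * f z =
    f (inl u) + f (inl v) + \sum_z (edge z y)%:R * f (inr z).
  by rewrite sum_cone /= !mul1r.
split=> [/gen_adjacency_eigenP E|[E1 E2]].
  split=> [|y]; last by rewrite -E deg_base baseE.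
  apply: (mulfI gamma_neq0); have := E (inl u).
  rewrite deg_apex apexE /theta => /eqP; rewrite -subr_eq0 => /eqP E0.
  by rewrite mulr0 -[RHS]E0; ring.
apply/gen_adjacency_eigenP => -[x|y]; last by rewrite deg_base baseE.
rewrite deg_apex apexE /theta; apply/eqP; rewrite -subr_eq0; apply/eqP.
by rewrite -[RHS](mulr0 gamma) -[in RHS]E1; ring.
Qed.

(** Exchanging the two sums turns the adjacency terms into
[gamma * deg z * f z], which merge with the diagonal terms
[beta * deg z * f z] into [c * f z]. *)
Lemma sum_base_eqs (f : join X H -> R) :
  \sum_(y : H) ((alpha + beta * (2 + (deg y)%:R)) * f (inr y)
    + gamma * (f (inl u) + f (inl v) + \sum_z (edge z y)%:R * f (inr z)))
  = (alpha + 2 * beta + c) * (\sum_y f (inr y))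
    + gamma * m * (f (inl u) + f (inl v)).
Proof.
rewrite big_split /= -mulr_sumr big_split /= sumr_const -/m.
have -> : \sum_y \sum_z (edge z y)%:R * f (inr z) =
    \sum_(z : H) (deg z)%:R * f (inr z).
  rewrite exchange_big; apply: eq_bigr => z _.
  by rewrite natr_deg mulr_suml; apply: eq_bigr => y _; rewrite edge_sym.
rewrite -[_ *+ #|_|]mulr_natl -/m [gamma * (_ * _ + _)]mulrDr addrCA addrC.
congr (_ + _); last by ring.
rewrite !mulr_sumr -big_split; apply: eq_bigr => y _ /=.
by rewrite -(deg_c y); ring.
Qed.

Lemma apex_diff_eigen :
  (char_vec R (inl u : join X H) - char_vec R (inl v : join X H)) *m M =
  theta *: (char_vec R (inl u : join X H) - char_vec R (inl v : join X H)).
Proof.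
pose f (x : join X H) : R := (x == inl u)%:R - (x == inl v)%:R.
have -> : char_vec R (inl u : join X H) - char_vec R (inl v : join X H)
    = row_of_fun f.
  apply/rowP => i; rewrite -[i]enum_valK !mxE enum_rankK.
  by rewrite !(inj_eq enum_rank_inj).
have fH y : f (inr y) = 0 by rewrite /f subrr.
have fX : f (inl u) + f (inl v) = 0.
  by rewrite /f !eqxx (eq_sym (inl v)) addrC subrKA subrr.
apply/cone_eigenP; rewrite fX; split=> [|y].
  by rewrite mulr0 add0r big1 // => y _.
by rewrite fH !mulr0 !add0r big1 ?mulr0 // => z _; rewrite fH mulr0.
Qed.

(** Summing the equations over [H] rules out the [theta]-eigenvectors with a
nonzero apex sum, except in the excluded case; there, a vector that is constant
on the apexes and on [H] is such an eigenvector. *)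
Lemma strongly_cospectral_double_cone :
  strongly_cospectral M (inl u) (inl v) <->
  ~ (edge u v /\ c = (beta + gamma) * (m - 1)).
Proof.
have m_neq0 : m != 0 by rewrite pnatr_eq0 -lt0n.
rewrite (strongly_cospectral_twins (gen_adjacency_mx_sym _ _ _) _ apex_diff_eigen)
  //.
split=> [sum0 [edge_uv cE]|nec x].
  (* The equation at an apex requires the [m] equal values on [H] to sum to -2. *)
  pose f (x : join X H) : R := if x is inl _ then 1 else - 2 / m.
  have sumf : \sum_(y : H) f (inr y) = - 2.
    by rewrite sumr_const -[_ *+ #|_|]mulr_natr -/m divfK.
  have /sum0 : row_of_fun f *m M = theta *: row_of_fun f.
    apply/cone_eigenP; rewrite sumf /theta /e edge_uv; split=> [|y] /=; first by ring.
    rewrite -mulr_suml -natr_deg.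
    have -> : (alpha + beta * (2 + (deg y)%:R)) * (- 2 / m)
        + gamma * (1 + 1 + (deg y)%:R * (- 2 / m))
        = (alpha + 2 * beta + (beta + gamma) * (deg y)%:R) * (- 2 / m)
          + 2 * gamma by ring.
    by rewrite deg_c cE; field.
  by rewrite !mxE !enum_rankK /f => /eqP; rewrite -[1 + 1]/(2%:R) pnatr_eq0.
rewrite -(row_of_funK x); set f := fun y => _; rewrite !mxE !enum_rankK.
case/cone_eigenP; set s := f (inl u) + f (inl v) => sumh base.
have := sum_base_eqs f; under eq_bigr do rewrite base; rewrite -mulr_sumr -/s.
move/eqP: sumh; rewrite addrC addr_eq0 => /eqP -> E.
suff /eqP : (gamma * m + e * (beta * (m + e) - gamma * e - 2 * beta - c)) * s = 0.
  rewrite mulf_eq0 => /orP[/eqP E0|/eqP //]; move: E0; rewrite /e.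
  case: (boolP (edge u v)) nec => [_ nec E0|_ _ /eqP].
    case: nec; split=> //; apply/eqP; rewrite -subr_eq0 -oppr_eq0 -E0; apply/eqP.
    by rewrite /=; ring.
  by rewrite mul0r addr0 mulf_eq0 (negPf gamma_neq0) (negPf m_neq0).
move/eqP: E; rewrite eq_sym -subr_eq0 => /eqP <-; rewrite /theta; ring.
Qed.

End DoubleCone.

(** * Regular graphs of maximal degree *)

Lemma deg_isomorphic {G H : sgraph} {f : G -> H} : bijective f ->
  (forall x y, edge (f x) (f y) = edge x y) -> forall x, deg (f x) = deg x.
Proof.
move=> bij_f edge_f x; rewrite /deg -(card_imset _ (bij_inj bij_f)).
apply: eq_card => y; have [g fK gK] := bij_f.
by rewrite inE -(gK y) edge_f (mem_imset _ _ (bij_inj bij_f)) inE.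
Qed.

Lemma deg_complete_graph (n : nat) (x : complete_graph n) : deg x = (n - 1)%N.
Proof.
rewrite /deg -[in RHS](card_ord n) subn1 -(cardsC1 x).
by apply: eq_card => y; rewrite !inE /= /complete_rel eq_sym.
Qed.

(** A neighbourhood is contained in the complement of its vertex, which has
[m - 1] elements; so a vertex of degree [m - 1] is adjacent to all others.  For
the converse, [m > 0] provides a vertex at which to compare degrees. *)
Lemma regular_completeP {H : sgraph} {d m : nat} :
  #|H| = m -> (0 < m)%N -> regular H d ->
  d = (m - 1)%N <-> isomorphic H (complete_graph m).
Proof.
move=> cardH m_gt0 regH; split=> [dE|[f bij_f edge_f]].
  exists (fun x => cast_ord cardH (enum_rank x)).
    by apply: bij_comp; [exists (cast_ord (esym cardH)); [exact: cast_ordK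
      | exact: cast_ordKV] | exact: enum_rank_bij].
  move=> x y; rewrite /= /complete_rel (inj_eq (@cast_ord_inj _ _ _)).
  rewrite (inj_eq enum_rank_inj).
  have : [set y | edge x y] = [set~ x].
    apply/eqP; rewrite eqEcard cardsC1 cardH -subn1 -dE -(regH x) leqnn andbT.
    by apply/subsetP => z; rewrite !inE; apply: contraTneq => ->; rewrite edge_irr.
  by move/setP/(_ y); rewrite !inE eq_sym.
have /card_gt0P[x _] : (0 < #|H|)%N by rewrite cardH.
by rewrite -(regH x) -(deg_isomorphic bij_f edge_f) deg_complete_graph.
Qed.

Theorem corollary6p9 (R : realType) (alpha beta gamma : R) (H : sgraph) (m : nat)
    (hgamma : gamma != 0) (hm : #|H| = m) (hm1 : (1 <= m)%N) :
  let Gd := disconnected_double_cone H in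
  let Gc := connected_double_cone H in
  let SCd := strongly_cospectral (gen_adjacency_mx Gd alpha beta gamma)
               (inl ord0) (inl ord_max) in
  let SCc := strongly_cospectral (gen_adjacency_mx Gc alpha beta gamma)
               (inl ord0) (inl ord_max) in
  (forall d : nat, regular H d ->
     SCd /\
     (beta != - gamma ->
        (SCc <-> d <> (m - 1)%N) /\
        (d <> (m - 1)%N <-> ~ isomorphic H (complete_graph m)))) /\
  (beta = - gamma -> SCd /\ ~ SCc).
Proof.
move=> Gd Gc SCd SCc.
have H_gt0 : (0 < #|H|)%N by rewrite hm.
have two (x : 'I_2) : x = ord0 \/ x = ord_max.
  by case: x => [[|[|//]] ?]; [left | right]; apply: val_inj.
have SCdP c : (forall y : H, (beta + gamma) * (deg y)%:R = c) -> SCd.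
  move=> deg_c; apply/(strongly_cospectral_double_cone alpha beta gamma c) => //.
  by case.
have SCcP c : (forall y : H, (beta + gamma) * (deg y)%:R = c) ->
    SCc <-> c <> (beta + gamma) * (m%:R - 1).
  move=> deg_c; rewrite -hm.
  have [SC_nec SC_suf] := strongly_cospectral_double_cone (X := complete_graph 2)
    (u := ord0) (v := ord_max) alpha beta gamma c hgamma H_gt0 isT two deg_c.
  by split=> [/SC_nec ne E|ne]; [apply: ne | apply: SC_suf => -[_]].
split=> [d regH|beta_gamma].
  have deg_d (y : H) : (beta + gamma) * (deg y)%:R = (beta + gamma) * d%:R.
    by rewrite regH.
  split=> [|neq_bg]; first exact: SCdP deg_d.
  have bg_neq0 : beta + gamma != 0 by rewrite addr_eq0.
  have iso := regular_completeP hm hm1 regH.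
  split; last by split=> ne /iso.
  rewrite (SCcP _ deg_d); have <- : (m - 1)%:R = m%:R - 1 :> R by rewrite natrB.
  split=> ne E; apply: ne; first by rewrite E.
  by move/(mulfI bg_neq0)/eqP: E; rewrite eqr_nat => /eqP.
have deg_0 (y : H) : (beta + gamma) * (deg y)%:R = 0.
  by rewrite beta_gamma addNr mul0r.
split; first exact: SCdP deg_0.
by case/(SCcP _ deg_0); rewrite beta_gamma addNr mul0r.
Qed.
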